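(* Let $\mathcal X$ be a finite state space, $\mathcal H:\mathcal X\to\mathbb R$, $Q$ a symmetric irreducible generator on $\mathcal X$, let $f,c$ satisfy the standing assumption described in the context, and let $\boldsymbol\alpha=(\alpha_t)_{t\ge0}$ be a non-negative differentiable penalty schedule. If $\alpha_t\downarrow0$ and $\alpha_t'=\frac{d\alpha_t}{dt}\to0$ as $t\to\infty$, then for any $x\in\mathcal X$, $$\left\|(P^f_{1,\boldsymbol\alpha,c})^t(x,\cdot)-\mu\right\|_{TV}\to0\quad\text{as }t\to\infty .$$
   Context: Setting. $\mathcal X$ is a finite set, $\mathcal H:\mathcal X\to\mathbb R$, $\mathcal H_{\min}=\min_x\mathcal H(x)$, $\mathcal H_{\max}=\max_x\mathcal H(x)$, $\mu(x)\propto e^{-\mathcal H(x)}$ the target probability distribution. $Q$ is a symmetric irreducible generator on $\mathcal X$ (the proposal chain). Standing assumption: $f:\mathbb R^+\to\mathbb R^+$ is differentiable, non-negative, non-decreasing with $f(0)=0$; $\mathcal H_{\min}\le c\le\mathcal H_{\max}$; the penalty parameter is non-negative. For $\alpha\ge0$: $\mathcal H^f_{1,\alpha,c}(x)=\int_{\mathcal H_{\min}}^{\mathcal H(x)}\frac{1}{\alpha f((u-c)_+)+1}\,du$, where $y_+=\max\{y,0\}$, and the generator $M^f_{1,\alpha,c}$ is given by $M^f_{1,\alpha,c}(x,y)=Q(x,y)e^{-(\mathcal H^f_{1,\alpha,c}(y)-\mathcal H^f_{1,\alpha,c}(x))_+}$ for $x\ne y$, $M^f_{1,\alpha,c}(x,x)=-\sum_{y\ne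 x}M^f_{1,\alpha,c}(x,y)$. $X^f_{1,\boldsymbol\alpha,c}=(X^f_{1,\boldsymbol\alpha,c}(t))_{t\ge0}$ is the time-inhomogeneous continuous-time Markov chain whose generator at time $t$ is $M^f_{1,\alpha_t,c}$, and $(P^f_{1,\boldsymbol\alpha,c})^t(x,A)=\mathbb P_x(X^f_{1,\boldsymbol\alpha,c}(t)\in A)$ is its time-$t$ law started at $x$ at time $0$. $\|\nu_1-\nu_2\|_{TV}=\frac12\sum_x|\nu_1(x)-\nu_2(x)|$. *)

(* Defs.v *)
From HB Require Import structures.
From mathcomp Require Import all_boot all_order all_algebra.
From mathcomp Require Import all_classical all_reals all_analysis.

Set Implicit Arguments.
Unset Strict Implicit.
Unset Printing Implicit Defensive.

Import Order.TTheory GRing.Theory Num.Theory.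
Import numFieldNormedType.Exports.

Local Open Scope classical_set_scope.
Local Open Scope ring_scope.

(* Functions on the half-line [0, +oo[ are encoded as total functions R -> R
   whose values at negative reals are never constrained; accordingly,
   differentiability at the endpoint 0 is one-sided. *)
Definition differentiable_Rplus (R : realType) (g : R -> R) : Prop :=
  (forall t : R, 0 < t -> derivable g t 1) /\
  cvg (h^-1 * (g h - g 0) @[h --> 0^'+]).

Definition penalty_function (R : realType) (f : R -> R) : Prop :=
  [/\ differentiable_Rplus f,
      forall u : R, 0 <= u -> 0 <= f u,
      forall u v : R, 0 <= u -> u <= v -> f u <= f v
    & f 0 = 0].

Section FiniteStateSpace.
Context {R : realType} {X : finType}.
Implicit Types (H nu : X -> R) (L Q : X -> X -> R) (f : R -> R).

Definition is_generator L : Prop :=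
  (forall x y, x != y -> 0 <= L x y) /\ (forall x, \sum_y L x y = 0).

Definition symmetric_generator L : Prop := forall x y, L x y = L y x.

(* The diagonal entries of a generator are nonpositive, so the relation below
   only has the off-diagonal transitions of positive rate. *)
Definition irreducible_generator L : Prop :=
  forall x y, connect [rel a b | 0 < L a b] x y.

(* x0 only witnesses that X is nonempty: the values do not depend on it. *)
Definition Hmin (x0 : X) H : R := \big[Num.min/H x0]_x H x.
Definition Hmax (x0 : X) H : R := \big[Num.max/H x0]_x H x.

Definition gibbs H (x : X) : R := expR (- H x) / \sum_y expR (- H y).

Definition modified_H (x0 : X) H f (c a : R) (x : X) : R :=
  \int[lebesgue_measure]_(u in `[Hmin x0 H, H x])
    (a * f (Num.max (u - c) 0) + 1)^-1.

Definition metropolis_rate Q (K : X -> R) (x y : X) : R :=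
  Q x y * expR (- Num.max (K y - K x) 0).

Definition metropolis_generator Q (K : X -> R) (x y : X) : R :=
  if x == y then - \sum_(z | z != x) metropolis_rate Q K x z
  else metropolis_rate Q K x y.

Definition M1 Q (x0 : X) H f (c a : R) : X -> X -> R :=
  metropolis_generator Q (modified_H x0 H f c a).

Definition TV (nu1 nu2 : X -> R) : R := 2^-1 * \sum_x `|nu1 x - nu2 x|.

Definition transition_function (P : R -> R -> X -> X -> R) : Prop :=
  [/\ forall (s t : R) x y, 0 <= s -> s <= t -> 0 <= P s t x y,
      forall (s t : R) x, 0 <= s -> s <= t -> \sum_y P s t x y = 1,
      forall (s : R) x y, 0 <= s -> P s s x y = (x == y)%:R
    & forall (s t u : R) x z, 0 <= s -> s <= t -> t <= u ->
        P s u x z = \sum_y P s t x y * P t u y z].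

(* G t is the generator at time t: both P t (t + h) and P (t - h) t are
   1 + h * G t + o(h) as h decreases to 0. The condition on the past is needed
   to exclude jumps of positive probability at a deterministic time. *)
Definition has_generator (P : R -> R -> X -> X -> R) (G : R -> X -> X -> R)
  : Prop :=
  (forall (t : R) x y, 0 <= t ->
    h^-1 * (P t (t + h) x y - (x == y)%:R) @[h --> 0^'+] --> G t x y) /\
  (forall (t : R) x y, 0 < t ->
    h^-1 * (P (t - h) t x y - (x == y)%:R) @[h --> 0^'+] --> G t x y).

End FiniteStateSpace.

Section MarkovChain.
Context {R : realType} {X : finType} {d : measure_display}
  {Omega : measurableType d}.
Variables (Pr : probability Omega R) (Y : R -> Omega -> X).

(* Finite-dimensional form of the Markov property, multiplied out so that no
   conditioning on null events occurs: tau, xi are arbitrary past times and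
   states, s is the present and t the future. *)
Definition markov_with (P : R -> R -> X -> X -> R) : Prop :=
  forall (n : nat) (tau : 'I_n -> R) (xi : 'I_n -> X) (s t : R) (y z : X),
    (forall i, 0 <= tau i <= s) -> 0 <= s -> s <= t ->
    let past := [set w | (forall i, Y (tau i) w = xi i) /\ Y s w = y] in
    Pr (past `&` [set w | Y t w = z]) = (Pr past * (P s t y z)%:E)%E.

Definition inhomogeneous_ctmc (G : R -> X -> X -> R) : Prop :=
  (forall (t : R) y, 0 <= t -> measurable [set w | Y t w = y]) /\
  exists P : R -> R -> X -> X -> R,
    [/\ transition_function P, has_generator P G & markov_with P].

Definition starts_at (x : X) : Prop := Pr [set w | Y 0 w = x] = 1%E.

Definition law_at (t : R) (y : X) : R := fine (Pr [set w | Y t w = y]).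

End MarkovChain.

(* Main.v *)
(** Let [G t] be the generator at time [t] and [mu] the Gibbs distribution. As
the penalty vanishes, [G t] converges entrywise to the plain Metropolis generator
[G], which is irreducible and reversible for [mu]. The forward equation
[p' = p G t] for the law [p] of the chain makes the chi-square distance
[V = \sum_x mu x * (p x / mu x - 1) ^+ 2] satisfy [V' <= - k V + e] with [k > 0]
from the Poincare inequality for [G], and [e t --> 0] because [p] is bounded and
[G t --> G]; hence [V --> 0]. *)
Require Import Defs.
From mathcomp Require Import all_boot all_order all_algebra.
From mathcomp Require Import all_classical all_reals all_analysis.
From mathcomp Require Import ring lra.
Import Order.TTheory GRing.Theory Num.Theory.
Import numFieldNormedType.Exports.
Local Open Scope classical_set_scope.
Local Open Scope ring_scope.

(** * Limits and derivatives of finite sums; a differential inequality *)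

Lemma cvg_sumr {R : realType} {T : Type} {F : set_system T} {FF : Filter F}
    {I : finType} (P : pred I) (f : I -> T -> R) (l : I -> R) :
  (forall i, P i -> f i t @[t --> F] --> l i) ->
  \sum_(i | P i) f i t @[t --> F] --> \sum_(i | P i) l i.
Proof. exact: (cvg_big add_continuous). Qed.

Lemma is_derive_sumr (R : realType) (I : finType) (f : I -> R -> R)
    (df : I -> R) (t : R) :
  (forall i, is_derive t 1 (f i) (df i)) ->
  is_derive t 1 (fun s => \sum_i f i s) (\sum_i df i).
Proof.
move=> H; have -> : (fun s => \sum_i f i s) = \sum_i f i.
  by apply/funext => s; rewrite fct_sumE.
by elim/big_ind2 : _ => // [|] *; [exact: is_derive_cst|exact: is_deriveD].
Qed.

(** Serves to turn the two conditions of [has_generator], both stated with [h] decreasing to 0, into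
    a genuine derivative. The second quotient becomes the left limit of the usual one after
    replacing [h] by [- h]. *)
Lemma is_derive_left_right (R : realType) (f : R -> R) (t l : R) :
  h^-1 * (f (t + h) - f t) @[h --> 0^'+] --> l ->
  h^-1 * (f t - f (t - h)) @[h --> 0^'+] --> l ->
  is_derive t 1 f l.
Proof.
move=> fr fl.
have cf : h^-1 *: ((f \o shift t) (h *: 1) - f t) @[h --> 0^'] --> l.
  apply: (@cvg_at_right_left_dnbhs _ R^o).
    apply: cvg_trans fr; apply: near_eq_cvg; near=> h => /=.
    by rewrite /GRing.scale/= mulr1 [h + t]addrC.
  apply/cvg_at_leftNP; rewrite oppr0.
  apply: cvg_trans fl; apply: near_eq_cvg; near=> h => /=.
  by rewrite /GRing.scale/= mulr1 [- h + t]addrC invrN mulNr -mulrN opprB.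
apply: DeriveDef; first by apply/cvg_ex; exists l.
exact: cvg_lim.
Unshelve. all: by end_near. Qed.

(** A Gronwall argument: once [e] stays below [k * (eps / 2)], the function
    [(V t - eps / 2) * expR (k * t)] is nonincreasing, so [V] exceeds [eps / 2] by at most an
    exponentially decaying term. *)
Lemma cvg_to0_of_derive_le (R : realType) (V dV e : R -> R) (k : R) :
  0 < k -> (forall t : R, 0 < t -> 0 <= V t) ->
  (forall t : R, 0 < t -> is_derive t 1 V (dV t)) ->
  (forall t : R, 0 < t -> dV t <= - k * V t + e t) ->
  e t @[t --> +oo] --> 0 -> V t @[t --> +oo] --> 0.
Proof.
move=> k0 V0 dVV dVle e0; apply/cvgrPdist_le => eps eps0.
have d0 : 0 < k * (eps / 2) by rewrite mulr_gt0// divr_gt0.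
have [T [_ HT]] : \forall t \near +oo, `|0 - e t| < k * (eps / 2).
  exact: cvgr_dist_lt.
(* The bound on [e] holds strictly beyond [T] and the derivative of [V] is known at positive times;
   [S] meets both constraints. *)
pose S := Num.max T 0 + 1.
have S0 : 0 < S by rewrite /S ltr_pwDr// le_max lexx orbT.
have TS : T < S by rewrite /S ltr_pwDr// le_max lexx.
pose W t := (V t - eps / 2) * expR (k * t).
have dW t : S <= t -> is_derive t 1 W
    ((dV t + k * (V t - eps / 2)) * expR (k * t)).
  move=> St; have t0 : 0 < t by exact: lt_le_trans St.
  have ? := dVV _ t0.
  have -> : W = (V \- cst (eps / 2)) * (expR \o ( *%R k)) by [].
  have dexp : is_derive t 1 (expR \o ( *%R k)) (expR (k * t) * k).
    apply: is_derive1_comp.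
    have -> : *%R k = k *: (@id R) by [].
    by apply: is_derive_eq; rewrite /GRing.scale/= mulr1.
  apply: is_derive_eq; rewrite /= subr0 /GRing.scale/=.
  by ring.
have Wle t : S <= t -> W t <= W S.
  move=> St; apply: (@ler0_derive1_nincry R W S) => //.
  - by move=> u; rewrite in_itv/= andbT => /ltW /dW[].
  - move=> u; rewrite in_itv/= andbT => /ltW Su; have := dW _ Su => dWu.
    rewrite derive1E derive_val mulr_le0_ge0 ?expR_ge0//.
    have u0 : 0 < u by exact: lt_le_trans Su.
    (* The terms in [k * V u] cancel, leaving [e u - k * (eps / 2) < 0]. *)
    have := dVle _ u0; have := HT u (lt_le_trans TS Su).
    rewrite sub0r normrN => /(le_lt_trans (ler_norm _)); nra.
  - apply: derivable_within_continuous => u.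
    by rewrite in_itv/= andbT => /dW[].
have kt : expR (- (k * t)) @[t --> +oo] --> (0 : R).
  apply: (@cvg_comp _ _ _ ( *%R k) (fun x => expR (- x)) _ +oo); last first.
    exact: cvgr_expR.
  by apply: gt0_cvgMry => //; exact: cvg_id.
have : `|W S| * expR (- (k * t)) @[t --> +oo] --> (0 : R).
  by rewrite -(mulr0 `|W S|); apply: cvgMl_tmp.
move=> /cvgr_dist_lt /(_ _ (divr_gt0 eps0 (ltr0n _ 2))).
apply: filter_app; near=> t.
have St : S <= t by near: t; apply: nbhs_pinfty_ge; exact: num_real.
rewrite sub0r normrN ger0_norm ?mulr_ge0 ?expR_ge0// => small.
rewrite sub0r normrN ger0_norm; last exact/V0/(lt_le_trans S0).
have : V t - eps / 2 <= W S * expR (- (k * t)).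
  by rewrite expRN ler_pdivlMr ?expR_gt0// Wle.
have : W S * expR (- (k * t)) <= `|W S| * expR (- (k * t)).
  by rewrite ler_wpM2r ?expR_ge0// ler_norm.
lra.
Unshelve. all: by end_near. Qed.

(** * Dirichlet form and Poincare inequality *)

Section DirichletForm.
Context {R : realType} {X : finType}.
Implicit Types (S : X -> X -> R) (h mu : X -> R).

(* Summing over ordered pairs gives twice the usual Dirichlet form. *)
Definition dirichlet S h : R := \sum_x \sum_y S x y * (h x - h y) ^+ 2.

Lemma dirichlet_ge0 S h : (forall x y, x != y -> 0 <= S x y) ->
  0 <= dirichlet S h.
Proof.
move=> S0; apply: sumr_ge0 => x _; apply: sumr_ge0 => y _.
have [->|xy] := eqVneq x y; first by rewrite subrr expr0n mulr0.
by rewrite mulr_ge0 ?sqr_ge0 ?S0.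
Qed.

(** Expand the square: the terms in [h x ^+ 2] vanish because rows sum to 0, those in [h y ^+ 2]
    because columns do by symmetry, and only the cross term is left. *)
Lemma dirichlet_parts S h : (forall x y, S x y = S y x) ->
  (forall x, \sum_y S x y = 0) ->
  2 * (\sum_x \sum_y h x * S x y * h y) = - dirichlet S h.
Proof.
move=> Ssym S0.
have -> : dirichlet S h = (\sum_x \sum_y h x ^+ 2 * S x y) +
    (\sum_x \sum_y h y ^+ 2 * S x y) - 2 * (\sum_x \sum_y h x * S x y * h y).
  rewrite mulr_sumr -big_split -sumrB; apply: eq_bigr => x _ /=.
  rewrite mulr_sumr -big_split -sumrB; apply: eq_bigr => y _ /=.
  by ring.
have Z : \sum_x \sum_y h x ^+ 2 * S x y = 0.
  by apply: big1 => x _; rewrite -mulr_sumr S0 mulr0.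
have Z' : \sum_x \sum_y h y ^+ 2 * S x y = 0.
  rewrite exchange_big -[RHS]Z; apply: eq_bigr => x _.
  by apply: eq_bigr => y _; rewrite Ssym.
by rewrite Z Z' !add0r opprK.
Qed.

(** The variance as half the mean square difference of two independent copies: the cross term
    factors through the mean of [h], which is 0. *)
Lemma sum_pairs_sqr mu h : \sum_x mu x = 1 -> \sum_x mu x * h x = 0 ->
  \sum_x \sum_y mu x * mu y * (h x - h y) ^+ 2 = 2 * \sum_x mu x * h x ^+ 2.
Proof.
move=> mu1 muh.
transitivity (\sum_x (mu x * h x ^+ 2 + mu x * (\sum_y mu y * h y ^+ 2))).
  apply: eq_bigr => x _.
  transitivity (\sum_y (mu x * h x ^+ 2 * mu y + mu x * (mu y * h y ^+ 2)
     - 2 * mu x * h x * (mu y * h y))).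
    by apply: eq_bigr => y _; ring.
  by rewrite sumrB big_split/= -!mulr_sumr mu1 muh mulr1 mulr0 subr0.
by rewrite big_split/= -mulr_suml mu1 mul1r; ring.
Qed.

(** Induction along a path: an edge [x z] of positive weight contributes a single term of the form,
    so [(S x z)^-1] works for it, and [(a + b) ^+ 2 <= 2 * a ^+ 2 + 2 * b ^+ 2] joins it to the rest
    of the path. The constant depends on the path but not on [h]. *)
Lemma connect_dirichlet S : (forall x y, x != y -> 0 <= S x y) ->
  forall x y, connect [rel a b | 0 < S a b] x y ->
  exists2 K, 0 <= K & forall h, (h x - h y) ^+ 2 <= K * dirichlet S h.
Proof.
move=> S0 x y /connectP[p]; elim: p x => [|z p IH] x /=.
  by move=> _ ->; exists 0 => // h; rewrite subrr expr0n mul0r.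
move=> /andP[xz zp] ylast; have [K K0 HK] := IH z zp ylast.
exists (2 * (S x z)^-1 + 2 * K) => [|h].
  by rewrite addr_ge0 ?mulr_ge0 ?invr_ge0 ?(ltW xz).
have := HK h.
have : (h x - h z) ^+ 2 <= (S x z)^-1 * dirichlet S h.
  rewrite ler_pdivlMl// /dirichlet (bigD1 x)//= (bigD1 z)//= -addrA lerDl.
  rewrite addr_ge0// !sumr_ge0// => a ax; last (apply: sumr_ge0 => b _);
    [have [->|xb] := eqVneq x a | have [->|xb] := eqVneq a b];
    by rewrite ?subrr ?expr0n ?mulr0// mulr_ge0 ?sqr_ge0 ?S0.
rewrite mulrDl -!mulrA.
(* Nonnegativity of [(a - b) ^+ 2] is exactly the inequality that bounds [(a + b) ^+ 2]. *)
have := sqr_ge0 (h x - h z - (h z - h y)).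
set D := dirichlet S h; set u := (S x z)^-1 * D; set v := K * D.
nra.
Qed.

(** One constant [M] bounds all squared differences by [M * dirichlet S h]; averaging over pairs
    with weights [mu x * mu y] bounds twice the variance, whence [k = 2 / M]. *)
Lemma poincare S mu : (forall x y, x != y -> 0 <= S x y) ->
  (forall x y, connect [rel a b | 0 < S a b] x y) ->
  (forall x, 0 <= mu x) -> \sum_x mu x = 1 ->
  exists2 k, 0 < k & forall h, \sum_x mu x * h x = 0 ->
    k * (\sum_x mu x * h x ^+ 2) <= dirichlet S h.
Proof.
move=> S0 Sc mu0 mu1.
have [K HK] : exists K : X * X -> R, forall z, 0 <= K z /\
    forall h, (h z.1 - h z.2) ^+ 2 <= K z * dirichlet S h.
  apply: (@fin_all_exists _ (fun=> R) (fun z k => 0 <= k /\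
    forall h, (h z.1 - h z.2) ^+ 2 <= k * dirichlet S h)) => -[x y].
  by have [K K0 HK] := connect_dirichlet S S0 x y (Sc x y); exists K.
(* The sum dominates every [K z]; the added 1 keeps [M] positive even if all of them are 0. *)
pose M := 1 + \sum_z K z.
have M0 : 0 < M by rewrite ltr_pwDl// sumr_ge0// => z _; case: (HK z).
exists (2 / M) => [|h muh]; first by rewrite divr_gt0.
rewrite mulrAC ler_pdivrMr// -sum_pairs_sqr// mulrC.
have MD x y : (h x - h y) ^+ 2 <= M * dirichlet S h.
  apply: le_trans ((HK (x, y)).2 h) _; rewrite ler_wpM2r ?dirichlet_ge0//.
  rewrite /M (bigD1 (x, y))//= addrCA lerDl addr_ge0// sumr_ge0// => z _.
  by case: (HK z).
have -> : M * dirichlet S h = \sum_x \sum_y mu x * mu y * (M * dirichlet S h).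
  under eq_bigr do rewrite -mulr_suml -mulr_sumr mu1 mulr1.
  by rewrite -mulr_suml mu1 mul1r.
apply: ler_sum => x _; apply: ler_sum => y _.
by rewrite ler_wpM2l// mulr_ge0.
Qed.

End DirichletForm.

(** * Kolmogorov forward equation *)

(** The Chapman-Kolmogorov identity splits off the last step of length [h], over [[t, t + h]] for
    the right derivative and over [[t - h, t]] for the left one. In the latter the weights
    [P 0 (t - h) x z] move with [h], so left continuity in time is proved first. *)
Lemma forward_equation (R : realType) (X : finType)
    (P : R -> R -> X -> X -> R) (G : R -> X -> X -> R) (x y : X) (t : R) :
  transition_function P -> has_generator P G -> 0 < t ->
  is_derive t 1 (fun s => P 0 s x y) (\sum_z P 0 t x z * G t z y).
Proof.
move=> [P0 P1 _ PM] [Gr Gl] t0; have t0' := ltW t0.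
have sumid s w : \sum_u P 0 s x u * (u == w)%:R = P 0 s x w.
  rewrite (bigD1 w)//= eqxx mulr1 big1 ?addr0// => u /negPf->.
  by rewrite mulr0.
have Pl z : P 0 (t - h) x z @[h --> 0^'+] --> P 0 t x z.
  have : \sum_u P 0 (t - h) x u * (P (t - h) t u z - (u == z)%:R) @[h --> 0^'+]
     --> (0 : R).
    rewrite -[X in _ --> X](_ : \sum_(u : X) 0 = 0); last by rewrite big1.
    apply: cvg_sumr => u _; apply/norm_cvg0P.
    (* The difference quotient converges, so the difference, which is [h] times it, tends to 0. *)
    have Z : P (t - h) t u z - (u == z)%:R @[h --> 0^'+] --> (0 : R).
      have : h * (h^-1 * (P (t - h) t u z - (u == z)%:R)) @[h --> 0^'+]
           --> 0 * G t u z.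
        apply: cvgM; last exact: Gl.
        by apply: cvg_at_right_filter; exact: cvg_id.
      rewrite mul0r; apply: cvg_trans; apply: near_eq_cvg; near=> h.
      by rewrite mulrA divff ?mul1r// gt_eqF.
    apply: (@squeeze_cvgr _ _ _ _ (cst 0)
      (fun h => `|P (t - h) t u z - (u == z)%:R|)); last exact/norm_cvg0P.
      near=> h.
      have th : 0 <= t - h by rewrite subr_ge0; near: h; exact: nbhs_right_le.
      rewrite normr_ge0/= normrM ler_piMl// ger0_norm ?P0//.
      rewrite -(P1 0 (t - h) x)// (bigD1 u)//= lerDl sumr_ge0// => v _.
      exact: P0.
    exact: cvg_cst.
  (* By Chapman-Kolmogorov the sum just shown to vanish is [P 0 t x z - P 0 (t - h) x z]. *)
  move=> /cvgN; rewrite oppr0 => /(cvgD (cvg_cst (P 0 t x z))).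
  rewrite addr0; apply: cvg_trans; apply: near_eq_cvg; near=> h.
  have th : 0 <= t - h by rewrite subr_ge0; near: h; exact: nbhs_right_le.
  have h0 : 0 < h by [].
  rewrite !fctE; under eq_bigr do rewrite mulrBr.
  rewrite sumrB sumid -(PM 0 (t - h) t)// ?gerBl ?ltW//.
  by rewrite opprB addrC subrK.
apply: is_derive_left_right.
  have : \sum_z P 0 t x z * (h^-1 * (P t (t + h) z y - (z == y)%:R))
      @[h --> 0^'+] --> \sum_z P 0 t x z * G t z y.
    apply: cvg_sumr => z _; apply: cvgMl_tmp; exact: Gr.
  apply: cvg_trans; apply: near_eq_cvg; near=> h.
  rewrite (PM 0 t (t + h))// ?lerDl; last by near: h; exact: nbhs_right_ge.
  rewrite -[in RHS](sumid t y) -sumrB mulr_sumr.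
  by apply: eq_bigr => z _; ring.
have : \sum_z P 0 (t - h) x z * (h^-1 * (P (t - h) t z y - (z == y)%:R))
    @[h --> 0^'+] --> \sum_z P 0 t x z * G t z y.
  by apply: cvg_sumr => z _; apply: cvgM; [exact: Pl|exact: Gl].
apply: cvg_trans; apply: near_eq_cvg; near=> h.
have th : 0 <= t - h by rewrite subr_ge0; near: h; exact: nbhs_right_le.
have h0 : 0 < h by [].
rewrite (PM 0 (t - h) t)// ?gerBl ?ltW//.
rewrite -[in RHS](sumid (t - h) y) -sumrB mulr_sumr.
by apply: eq_bigr => z _; ring.
Unshelve. all: by end_near. Qed.

(** * Convergence to equilibrium for generators with a reversible limit *)

(** Detailed balance says that [S x y = mu x * G x y] is symmetric, so the part of the chi-square
    derivative due to [G] is minus a Dirichlet form. The part due to [Gt t - G] goes into the error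
    [e]. *)
Lemma cvg_reversible (R : realType) (X : finType) (G : X -> X -> R)
    (mu : X -> R) (Gt : R -> X -> X -> R) (p : R -> X -> R) :
  is_generator G -> (forall x y, mu x * G x y = mu y * G y x) ->
  irreducible_generator G ->
  (forall x, 0 < mu x) -> \sum_x mu x = 1 ->
  (forall x y, Gt t x y @[t --> +oo] --> G x y) ->
  (forall t x, 0 < t -> 0 <= p t x) -> (forall t, 0 < t -> \sum_x p t x = 1) ->
  (forall (t : R) y, 0 < t ->
    is_derive t 1 (p^~ y) (\sum_x p t x * Gt t x y)) ->
  forall y, p t y @[t --> +oo] --> mu y.
Proof.
move=> [G0 G1] rev irr mu0 mu1 GtG p0 p1 dp y.
pose S x y := mu x * G x y.
have S0 a b : a != b -> 0 <= S a b by move=> ab; rewrite mulr_ge0 ?G0 ?ltW.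
have Sconn a b : connect [rel a b | 0 < S a b] a b.
  rewrite -(eq_connect (e := [rel a b | 0 < G a b])) ?irr// => u v /=.
  by rewrite pmulr_rgt0.
have S1 a : \sum_b S a b = 0 by rewrite -mulr_sumr G1 mulr0.
have S1' b : \sum_a S a b = 0.
  by under eq_bigr do rewrite /S rev; exact: S1.
have [k k0 Hk] := poincare S mu S0 Sconn (fun x => ltW (mu0 x)) mu1.
(* The density of the law relative to [mu], centered so that the Poincare inequality applies. *)
pose h t x := p t x / mu x - 1.
have ph t x : p t x = mu x * (1 + h t x).
  by rewrite /h addrCA subrr addr0 mulrCA divff ?mulr1// gt_eqF.
have p1le t x : 0 < t -> p t x <= 1.
  move=> t0; rewrite -(p1 t t0) (bigD1 x)//= lerDl sumr_ge0// => z _.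
  exact: p0.
have muh t : 0 < t -> \sum_x mu x * h t x = 0.
  move=> t0; transitivity (\sum_x (p t x - mu x)).
    by apply: eq_bigr => x _; rewrite ph; ring.
  by rewrite sumrB p1// mu1 subrr.
pose V t := \sum_x mu x * h t x ^+ 2.
pose dV t := \sum_x 2 * h t x * (\sum_z p t z * Gt t z x).
(* Since [0 <= p t z <= 1], one has [|h t x| <= 1 + (mu x)^-1]; this gives the coefficient. *)
pose e t := \sum_x \sum_z 2 * (1 + (mu x)^-1) * `|Gt t z x - G z x|.
have V0 t : 0 <= V t.
  by rewrite sumr_ge0// => x _; rewrite mulr_ge0 ?sqr_ge0 ?ltW.
suff VZ : V t @[t --> +oo] --> 0.
  have hZ : h t y @[t --> +oo] --> 0.
    apply/cvgrPdist_lt => eps eps0.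
    (* This threshold fits because [mu y * h t y ^+ 2] is one of the nonnegative terms of [V t]. *)
    have d0 : 0 < mu y * eps ^+ 2 by rewrite mulr_gt0 ?exprn_gt0.
    move: VZ => /cvgr_dist_lt /(_ _ d0); apply: filter_app; near=> t.
    rewrite !sub0r !normrN ger0_norm// => Veps.
    rewrite -ltr_sqr ?nnegrE ?normr_ge0 ?(ltW eps0)// real_normK ?num_real//.
    rewrite -(ltr_pM2l (mu0 y)); apply: le_lt_trans Veps.
    rewrite /V (bigD1 y)//= lerDl sumr_ge0// => x _.
    by rewrite mulr_ge0 ?sqr_ge0 ?ltW.
  have : mu y * (1 + h t y) @[t --> +oo] --> mu y * (1 + 0).
    by apply: cvgMl_tmp; apply: cvgD => //; exact: cvg_cst.
  rewrite addr0 mulr1; apply: cvg_trans; apply: near_eq_cvg; near=> t.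
  by rewrite ph.
apply: (@cvg_to0_of_derive_le _ V dV e k) => //.
- move=> t t0; apply: is_derive_sumr => x.
  have dh : is_derive t 1 (h^~ x) ((mu x)^-1 * \sum_z p t z * Gt t z x).
    have -> : h^~ x = (mu x)^-1 *: (p^~ x) - cst 1.
      by apply/funext => s; rewrite /h !fctE /GRing.scale/= mulrC.
    by have ? := dp t x t0; apply: is_derive_eq; rewrite subr0.
  have -> : (fun s => mu x * h s x ^+ 2) = mu x *: ((h^~ x) * (h^~ x)).
    by apply/funext => s; rewrite !fctE /GRing.scale/= expr2.
  apply: is_derive_eq; rewrite /GRing.scale/=.
  by field; rewrite gt_eqF.
- move=> t t0.
  have -> : dV t = 2 * (\sum_x \sum_z h t x * S x z * h t z) +
      \sum_x \sum_z 2 * h t x * p t z * (Gt t z x - G z x).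
    (* Write [p = mu * (1 + h)]: the constant 1 drops out because [mu] is invariant under [G], and
       reversibility transposes [S]. *)
    have step x : \sum_z p t z * G z x = \sum_z S x z * h t z.
      transitivity (\sum_z (S z x + S z x * h t z)).
        by apply: eq_bigr => z _; rewrite ph /S; ring.
      rewrite big_split/= S1' add0r.
      by apply: eq_bigr => z _; rewrite /S rev.
    rewrite mulr_sumr -big_split; apply: eq_bigr => x _ /=.
    transitivity (2 * h t x * (\sum_z p t z * G z x) +
       \sum_z 2 * h t x * p t z * (Gt t z x - G z x)).
      by rewrite !mulr_sumr -big_split; apply: eq_bigr => z _ /=; ring.
    rewrite step; congr (_ + _); rewrite !mulr_sumr.
    by apply: eq_bigr => z _; ring.
  rewrite dirichlet_parts//.
  apply: lerD; first by rewrite mulNr lerN2 Hk// muh.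
  apply: ler_sum => x _; apply: ler_sum => z _.
  apply: le_trans (ler_norm _) _; rewrite normrM ler_wpM2r//.
  rewrite !normrM (ger0_norm (ler0n _ 2)) -mulrA ler_wpM2l//.
  apply: le_trans (_ : `|h t x| * 1 <= _).
    by rewrite ler_wpM2l// ger0_norm ?p0// p1le.
  rewrite mulr1 /h; apply: le_trans (ler_normB _ _) _.
  rewrite normr1 addrC lerD2l ger0_norm; last first.
    by rewrite mulr_ge0 ?p0// invr_ge0 ltW.
  by rewrite ler_piMl ?p1le// invr_ge0 ltW.
rewrite -[X in _ --> X](_ : \sum_(x : X) \sum_(z : X) 0 = 0); last first.
  by rewrite big1// => x _; rewrite big1.
apply: cvg_sumr => x _; apply: cvg_sumr => z _.
rewrite -[X in _ --> X](mulr0 (2 * (1 + (mu x)^-1))).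
apply: cvgMl_tmp; apply/norm_cvg0P.
rewrite -(subrr (G z x)); apply: cvgB => //; exact: cvg_cst.
Unshelve. all: by end_near. Qed.

(** * Gibbs distribution and Metropolis generator *)

Lemma gibbs_gt0 (R : realType) (X : finType) (H : X -> R) (x : X) :
  0 < gibbs H x.
Proof.
rewrite divr_gt0 ?expR_gt0// (bigD1 x)//= ltr_pwDl ?expR_gt0//.
by rewrite sumr_ge0// => y _; rewrite expR_ge0.
Qed.

Lemma sum_gibbs (R : realType) (X : finType) (x : X) (H : X -> R) :
  \sum_y gibbs H y = 1.
Proof.
rewrite -mulr_suml divff// gt_eqF// (bigD1 x)//= ltr_pwDl ?expR_gt0//.
by rewrite sumr_ge0// => y _; rewrite expR_ge0.
Qed.

Section Metropolis.
Context {R : realType} {X : finType}.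
Implicit Types (Q : X -> X -> R) (H K : X -> R).

Lemma metropolis_is_generator Q K : is_generator Q ->
  is_generator (metropolis_generator Q K).
Proof.
move=> [Q0 _]; split=> [x y xy|x].
  by rewrite /metropolis_generator (negPf xy) mulr_ge0 ?Q0 ?expR_ge0.
rewrite (bigD1 x)//= {1}/metropolis_generator eqxx addrC.
apply/eqP; rewrite subr_eq0; apply/eqP/eq_bigr => y yx.
by rewrite /metropolis_generator eq_sym (negPf yx).
Qed.

(** The acceptance factor is an exponential, hence positive, so each off-diagonal edge of [Q]
    survives; loops connect nothing new. *)
Lemma metropolis_irreducible Q K : irreducible_generator Q ->
  irreducible_generator (metropolis_generator Q K).
Proof.
move=> irr x y; apply: connect_sub (irr x y) => a b /= ab.
have [->|neq] := eqVneq a b; first exact: connect0.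
apply: connect1; rewrite /= /metropolis_generator (negPf neq).
by rewrite mulr_gt0 ?expR_gt0.
Qed.

Lemma metropolis_reversible Q H : symmetric_generator Q -> forall x y,
  gibbs H x * metropolis_generator Q H x y =
  gibbs H y * metropolis_generator Q H y x.
Proof.
move=> Qsym x y; rewrite /metropolis_generator eq_sym.
have [->//|_] := eqVneq y x.
(* up to normalization, both sides are [Q x y * expR (- max (H x) (H y))] *)
have E u v : expR (- H u) * expR (- Num.max (H v - H u) 0) =
    expR (- Num.max (H v) (H u)).
  by rewrite -expRD -opprD addr_maxr subrKC addr0.
rewrite /metropolis_rate /gibbs (Qsym x y) mulrACA [RHS]mulrACA.
transitivity (expR (- H x) * expR (- Num.max (H y - H x) 0) *
  ((\sum_z expR (- H z))^-1 * Q y x)); first by ring.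
by rewrite E maxC -E; ring.
Qed.

(** The rates see energies only through differences, and depend on them continuously. Assuming
    convergence of differences lets [K t] tend to [H] up to an additive constant. *)
Lemma cvg_metropolis Q (K : R -> X -> R) H :
  (forall x y, K t y - K t x @[t --> +oo] --> H y - H x) ->
  forall x y, metropolis_generator Q (K t) x y @[t --> +oo] -->
    metropolis_generator Q H x y.
Proof.
move=> KH x y.
have max0 : continuous (fun d : R => Num.max d 0).
  have := @max_fun_continuous _ R R id (cst 0).
  by apply => r; [exact: cvg_id|exact: cvg_cst].
have rate u v : metropolis_rate Q (K t) u v @[t --> +oo] -->
    metropolis_rate Q H u v.
  apply: cvgMl_tmp.
  apply: continuous_cvg; first exact: continuous_expR.
  apply: cvgN.
  exact: (cvg_comp _ _ (KH u v) (max0 _)).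
rewrite /metropolis_generator; case: ifP => _ //.
by apply: cvgN; apply: cvg_sumr => z _; exact: rate.
Qed.

End Metropolis.

(** * The modified Hamiltonian as the penalty vanishes *)

Lemma Hmin_le (R : realType) (X : finType) (x0 x : X) (H : X -> R) :
  Hmin x0 H <= H x.
Proof. exact: bigmin_le_cond. Qed.

Section ModifiedHamiltonian.
Context {R : realType} {X : finType}.
Variables (x0 : X) (H : X -> R) (f : R -> R) (c : R).
Hypothesis hf : penalty_function f.

Lemma penalty_ge0 (u : R) : 0 <= f (Num.max (u - c) 0).
Proof. by case: hf => _ + _ _; apply; rewrite le_max lexx orbT. Qed.

Lemma penalty_homo : {homo (fun u => f (Num.max (u - c) 0)) : u v / u <= v}.
Proof.
move=> u v uv; case: hf => _ _ + _; apply; first by rewrite le_max lexx orbT.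
by rewrite ge_max !le_max lexx !orbT lerD2r uv.
Qed.

(** The integrand is nonincreasing and at most 1, so on the interval it lies between its value at
    the right end [H x] and 1. These explicit bounds reduce the limit of the integral to a
    squeeze. *)
Lemma modified_H_bounds (a : R) (x : X) : 0 <= a ->
  (H x - Hmin x0 H) * (a * f (Num.max (H x - c) 0) + 1)^-1
    <= modified_H x0 H f c a x <= H x - Hmin x0 H.
Proof.
move=> a0; set F := f _; rewrite /modified_H.
set D := `[Hmin x0 H, H x].
pose g (u : R) := (a * f (Num.max (u - c) 0) + 1)^-1.
rewrite -/(Rintegral _ _ g).
have den0 u : 1 <= a * f (Num.max (u - c) 0) + 1.
  by rewrite lerDr mulr_ge0// penalty_ge0.
have den0' u : 0 < a * f (Num.max (u - c) 0) + 1 by exact: lt_le_trans (den0 u).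
have D_itv : lebesgue_measure [set` D] = (H x - Hmin x0 H)%:E :> \bar R.
  (* The measure formula distinguishes the degenerate interval, which occurs when [x] is a minimizer
     of [H]. *)
  rewrite lebesgue_measure_itv/= lte_fin; case: ltP => // xm.
  rewrite (_ : H x = Hmin x0 H) ?subrr//.
  by apply/eqP; rewrite eq_le xm Hmin_le.
have mD : measurable [set` D] by exact: measurable_itv.
have int (k : R -> R) : measurable_fun setT k -> (forall u, 0 <= k u <= 1) ->
    lebesgue_measure.-integrable [set` D] (EFin \o k).
  move=> mk k01; apply: measurable_bounded_integrable => //.
  - by rewrite [ltLHS]D_itv ltry.
  - exact: measurable_funTS.
  - exists 1; split; first exact: num_real.
    move=> M M1 u _ /=; have /andP[k0 k1] := k01 u.
    by rewrite ger0_norm// (le_trans k1)// ltW.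
have g01 u : 0 <= g u <= 1.
  by rewrite invr_ge0 (ltW (den0' u))/= invf_le1.
(* Measurability comes from monotonicity. *)
have mg : measurable_fun setT g.
  apply: measurable_realfun.nonincreasing_measurable => // u v uv.
  by rewrite lef_pV2 ?posrE// lerD2r ler_wpM2l// penalty_homo.
have cst_int r :
    \int[lebesgue_measure]_(_ in [set` D]) r = r * (H x - Hmin x0 H).
  transitivity (r * fine (lebesgue_measure [set` D])); last by rewrite D_itv.
  exact: Rintegral_cst.
have F0 : 0 < a * F + 1 by exact: den0'.
have F01 : 0 <= (a * F + 1)^-1 <= 1 by exact: g01 (H x).
apply/andP; split.
  rewrite mulrC -cst_int; apply: le_Rintegral => //.
  - by apply: (int (cst _)) => //.
  - exact: int.
  - move=> u; rewrite /= in_itv/= => /andP[_ ux].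
    by rewrite /g lef_pV2 ?posrE// lerD2r ler_wpM2l// penalty_homo.
rewrite -[leRHS]mul1r -cst_int; apply: le_Rintegral => //.
- exact: int.
- by apply: (int (cst _)) => // u; rewrite /cst ler01 lexx.
- by move=> u _; case/andP: (g01 u).
Qed.

Lemma cvg_modified_H (alpha : R -> R) (x : X) :
  (forall t, 0 <= t -> 0 <= alpha t) -> alpha t @[t --> +oo] --> (0 : R) ->
  modified_H x0 H f c (alpha t) x @[t --> +oo] --> H x - Hmin x0 H.
Proof.
move=> alpha0 alphaZ; apply: squeeze_cvgr; last exact: cvg_cst.
  near=> t; apply: modified_H_bounds; apply: alpha0.
  by near: t; apply: nbhs_pinfty_ge; exact: num_real.
rewrite -[X in _ --> X]mulr1; apply: cvgMl_tmp.
rewrite -[X in _ --> X]invr1; apply: cvgV; first exact: oner_neq0.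
rewrite -[X in _ --> X]add0r; apply: cvgD; last exact: cvg_cst.
rewrite -[X in _ --> X](mul0r (f (Num.max (H x - c) 0))).
exact: cvgMr_tmp.
Unshelve. all: by end_near. Qed.

End ModifiedHamiltonian.

(** * Law of the chain and convergence in total variation *)

(** The Markov property with present time 0 and no past times: the event [Y 0 = x] has probability
    1, so intersecting with it leaves probabilities unchanged. *)
Lemma law_at_starts_at (R : realType) (X : finType) (d : measure_display)
    (Omega : measurableType d) (Pr : probability Omega R) (Y : R -> Omega -> X)
    (P : R -> R -> X -> X -> R) (x y : X) (t : R) :
  (forall (s : R) z, 0 <= s -> measurable [set w | Y s w = z]) ->
  markov_with Pr Y P -> starts_at Pr Y x -> 0 <= t ->
  law_at Pr Y t y = P 0 t x y.
Proof.
move=> mY PY Yx t0; rewrite /law_at; set B := [set w | Y t w = y].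
have B_ae : Pr B = Pr ([set w | Y 0 w = x] `&` B).
  have mA := mY 0 x (lexx 0); have mB : measurable B by exact: mY.
  rewrite [LHS](measureDI _ mB mA) setIC.
  rewrite [X in (X + _)%E](_ : _ = 0%E) ?add0e//; apply/eqP.
  rewrite eq_le measure_ge0 andbT.
  have <- : Pr (~` [set w | Y 0 w = x]) = 0%E.
    by rewrite probability_setC// Yx subee.
  by apply: le_measure; rewrite ?inE; [exact: measurableD|exact: measurableC|
    move=> w []].
pose tau (i : 'I_0) : R := 0; pose xi (i : 'I_0) : X := x.
have := PY 0%N tau xi 0 t x y (fun i => ltac:(by case: i)) (lexx 0) t0.
rewrite (_ : [set w | (forall i, Y (tau i) w = xi i) /\ Y 0 w = x] =
  [set w | Y 0 w = x]); last first.
  by apply/seteqP; split=> [w []//|w /= ->]; split=> // -[].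
by rewrite /= B_ae => ->; rewrite Yx mul1e.
Qed.

Theorem theorem5p2 (R : realType) (X : finType) (x0 : X) (H : X -> R)
  (Q : X -> X -> R) (f : R -> R) (c : R) (alpha : R -> R)
  (hQ : is_generator Q) (hQsym : symmetric_generator Q)
  (hQirr : irreducible_generator Q)
  (hf : penalty_function f)
  (hc : Hmin x0 H <= c <= Hmax x0 H)
  (halpha_ge0 : forall t : R, 0 <= t -> 0 <= alpha t)
  (halpha_diff : differentiable_Rplus alpha)
  (halpha_decr : forall s t : R, 0 <= s -> s <= t -> alpha t <= alpha s)
  (halpha_lim : alpha t @[t --> +oo] --> (0 : R))
  (halpha_deriv_lim : derive1 alpha t @[t --> +oo] --> (0 : R))
  (x : X)
  (d : measure_display) (Omega : measurableType d)
  (Pr : probability Omega R) (Y : R -> Omega -> X)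
  (hY : inhomogeneous_ctmc Pr Y (fun t => M1 Q x0 H f c (alpha t)))
  (hYx : starts_at Pr Y x) :
  TV (law_at Pr Y t) (gibbs H) @[t --> +oo] --> (0 : R).
Proof.
have [mY [P [tP gP PY]]] := hY.
have MG u v : M1 Q x0 H f c (alpha t) u v @[t --> +oo] -->
    metropolis_generator Q H u v.
  apply: cvg_metropolis => {u v} u v.
  (* The modified Hamiltonian tends to [H] shifted by [Hmin x0 H], and the shift cancels in
     differences. *)
  rewrite (_ : H v - H u = (H v - Hmin x0 H) - (H u - Hmin x0 H)); last by ring.
  by apply: cvgB; exact: cvg_modified_H.
have PZ y : P 0 t x y @[t --> +oo] --> gibbs H y.
  have [P0 P1 _ _] := tP.
  apply: (cvg_reversible R X (metropolis_generator Q H) (gibbs H)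
    (fun t => M1 Q x0 H f c (alpha t)) (fun t => P 0 t x)) => //.
  - exact: metropolis_is_generator.
  - exact: metropolis_reversible.
  - exact: metropolis_irreducible.
  - exact: gibbs_gt0.
  - exact: sum_gibbs.
  - by move=> t z t0; rewrite P0// ltW.
  - by move=> t t0; rewrite P1// ltW.
  - by move=> t z t0; exact: (forward_equation R X P _ x z t tP gP t0).
rewrite /TV -[X in _ --> X](mulr0 2^-1); apply: cvgMl_tmp.
rewrite -[X in _ --> X](_ : \sum_(y : X) 0 = 0); last by rewrite big1.
apply: cvg_sumr => y _; apply/norm_cvg0P.
rewrite -(subrr (gibbs H y)); apply: cvgB; last exact: cvg_cst.
(* The law agrees with [P 0 t x] at nonnegative times, hence eventually. *)
apply: cvg_trans (PZ y); apply: near_eq_cvg; near=> t.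
exact/esym/law_at_starts_at.
Unshelve. all: by end_near. Qed.
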